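(* Consider a finite irreducible Markov renewal process with state space $S=\{1,\dots,m\}$, embedded (jump) chain transition matrix $P$ with stationary probability vector $\pi$, mean sojourn time vector $\mu$, $\lambda=\pi^T\mu>0$, and mean first passage times $m_{ij}$. Let $k^{(1)}=(k^{(1)}_1,\dots,k^{(1)}_m)^T$ with $k_i^{(1)}=\sum_{j=1}^m \pi_j m_{ij}$. Then: (a) If $G$ is any g-inverse of $I-P$, then $$k^{(1)} = G\mu - \mathrm{tr}(G\mu\pi^T)e+\lambda e-\lambda Ge+\lambda\,\mathrm{tr}(G)e.$$ (b) If $Z=[I-P+\Pi]^{-1}$, then $$k^{(1)} = Z\mu-\mathrm{tr}(Z\mu\pi^T)e+\lambda\,\mathrm{tr}(Z)e.$$ (c) If $A^{\#}$ is the group inverse of $I-P$, then $$k^{(1)} = A^{\#}\mu-\mathrm{tr}(A^{\#}\mu\pi^T)e+\lambda e+\lambda\,\mathrm{tr}(A^{\#})e.$$ (d) If $\widetilde G=[I-P+\mu u^T]^{-1}$, where $u\in\mathbb{R}^m$ satisfies $u^Te\neq 0$, then $$k^{(1)}=\lambda\left[I-\widetilde G+\mathrm{tr}(\widetilde G)I\right]e.$$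
   Context: A Markov renewal process (MRP) $\{(X_n,T_n),n\ge 0\}$ on $S=\{1,\dots,m\}$ has $T_0=0\le T_1\le T_2\le\cdots$ and semi-Markov kernel $Q_{ij}(t)=P\{X_{n+1}=j,\ T_{n+1}-T_n\le t\mid X_n=i\}$ (Markov property: conditionally on the past up to step $n$, the law of $(X_{n+1},T_{n+1}-T_n)$ depends only on $X_n$, through this kernel). The embedded Markov chain $\{X_n\}$ has transition matrix $P=[p_{ij}]$, $p_{ij}=Q_{ij}(+\infty)$; the MRP is called irreducible when $P$ is irreducible. Put $\mu_{ij}=\int_0^\infty t\,dQ_{ij}(t)$, assumed finite, and $\mu_i=\sum_k\mu_{ik}$, the mean sojourn time on a visit to state $i$; $\mu=(\mu_1,\dots,\mu_m)^T$. $\pi=(\pi_1,\dots,\pi_m)^T$ is the unique vector with $\pi^TP=\pi^T$, $\pi^Te=1$, where $e=(1,\dots,1)^T$; $\Pi=e\pi^T$. $\lambda=\pi^T\mu$, assumed positive. The mean first passage time is $m_{ij}=E[T_{ij}\mid X_0=i]$, where $T_{ij}=T_n$ with $n=\min\{r\ge1: X_r=j\}$ given $X_0=i$ (the return time if $i=j$); these are all finite. A g-inverse (one-condition generalized inverse) of $I-P$ is any matrix $G$ with $(I-P)G(I-P)=I-P$. The group inverse $A^{\#}$ of $A=I-P$ is the unique matrix with $AA^{\#}A=A$, $A^{\#}AA^{\#}=A^{\#}$, $AA^{\#}=A^{\#}A$; it equals $Z-\Pi$. *)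

(* Defs.v *)
(* MathComp-Analysis *)
From HB Require Import structures.
From mathcomp Require Import all_boot all_order all_algebra.
From mathcomp Require Import all_classical all_reals all_analysis.

Set Implicit Arguments.
Unset Strict Implicit.
Unset Printing Implicit Defensive.

Import Order.TTheory GRing.Theory Num.Theory.
Import numFieldNormedType.Exports.

Local Open Scope classical_set_scope.
Local Open Scope ring_scope.

(* The sigma-algebra generated by X_0, T_0, ..., X_n, T_n. *)
Definition history {Omega : Type} {R : realType} {m : nat}
    (X : nat -> Omega -> 'I_m) (T : nat -> Omega -> R) (n : nat) :
    set (set Omega) :=
  <<s [set A | exists2 k, (k <= n)%N &
         (exists B : set 'I_m, A = X k @^-1` B) \/
         (exists2 B : set R, measurable B & A = T k @^-1` B)] >>.

(* The field mr_markov states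
     P(X_{n+1} = j, T_{n+1} - T_n <= t | X_0, T_0, ..., X_n, T_n) = Q_{X_n,j}(t)
   almost surely, multiplied out over the events A of the history, so that
   no division by P(X_n = i) is involved. *)
Record markov_renewal {d : measure_display} {Omega : measurableType d}
    {R : realType} {m : nat} (P : probability Omega R)
    (X : nat -> Omega -> 'I_m) (T : nat -> Omega -> R)
    (Q : 'I_m -> 'I_m -> cumulative R R) : Prop := MarkovRenewal {
  mr_measurable_X : forall n (j : 'I_m), measurable [set w | X n w = j] ;
  mr_measurable_T : forall n, measurable_fun setT (T n) ;
  mr_T0 : forall w, T 0%N w = 0 ;
  mr_T_mono : forall n w, T n w <= T n.+1 w ;
  mr_markov : forall n (A : set Omega) (i j : 'I_m) (t : R),
    history X T n A ->
    P (A `&` [set w | X n w = i] `&`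
         [set w | X n.+1 w = j /\ T n.+1 w - T n w <= t]) =
    (P (A `&` [set w | X n w = i]) * (Q i j t)%:E)%E }.

Definition trans_mx {R : realType} {m : nat}
    (Q : 'I_m -> 'I_m -> cumulative R R) : 'M[R]_m :=
  \matrix_(i, j) lim (Q i j t @[t --> +oo]).

Definition irreducible_mx {R : realType} {m : nat} (P : 'M[R]_m) : Prop :=
  forall i j, exists n : nat, 0 < (P ^+ n) i j.

Definition mean_sojourn_to {R : realType} {m : nat}
    (Q : 'I_m -> 'I_m -> cumulative R R) (i j : 'I_m) : \bar R :=
  (\int[lebesgue_stieltjes_measure (Q i j)]_(t in `[0%R, +oo[) t%:E)%E.

Definition mean_sojourn {R : realType} {m : nat}
    (Q : 'I_m -> 'I_m -> cumulative R R) : 'cV[R]_m :=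
  \col_i \sum_k fine (mean_sojourn_to Q i k).

(* T_n for n = min {r >= 1 : X_r = j}; +oo if j is not visited after time 0. *)
Definition first_passage {Omega : Type} {R : realType} {m : nat}
    (X : nat -> Omega -> 'I_m) (T : nat -> Omega -> R) (j : 'I_m) (w : Omega) :
    \bar R :=
  match pselect (exists r, (0 < r)%N && (X r w == j)) with
  | left visited => (T (ex_minn visited) w)%:E
  | right _ => +oo%E
  end.

(* Pr i is the law of the process given X_0 = i. *)
Definition mean_first_passage {d : measure_display} {Omega : measurableType d}
    {R : realType} {m : nat} (Pr : 'I_m -> probability Omega R)
    (X : nat -> Omega -> 'I_m) (T : nat -> Omega -> R) (i j : 'I_m) : \bar R :=
  (\int[Pr i]_w first_passage X T j w)%E.

(* Valued in \bar R because the mean first passage times are: an equation with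
   a real right-hand side then includes their finiteness. *)
Definition kvec1 {d : measure_display} {Omega : measurableType d}
    {R : realType} {m : nat} (Pr : 'I_m -> probability Omega R)
    (X : nat -> Omega -> 'I_m) (T : nat -> Omega -> R) (pi : 'cV[R]_m) :
    'cV[\bar R]_m :=
  \col_i (\sum_(j < m) (pi j 0)%:E * mean_first_passage Pr X T i j)%E.

Definition ones {R : realType} {m : nat} : 'cV[R]_m := const_mx 1.

Definition g_inverse {R : realType} {m : nat} (A G : 'M[R]_m) : Prop :=
  A *m G *m A = A.

Definition group_inverse {R : realType} {m : nat} (A B : 'M[R]_m) : Prop :=
  [/\ A *m B *m A = A, B *m A *m B = B & A *m B = B *m A].

(* Main.v *)
Require Import Defs.
From HB Require Import structures.
From mathcomp Require Import all_boot all_order all_algebra.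
From mathcomp Require Import all_classical all_reals all_analysis.
From mathcomp Require Import measurable_realfun ring.

Set Implicit Arguments.
Unset Strict Implicit.
Unset Printing Implicit Defensive.

Import Order.TTheory GRing.Theory Num.Theory.
Import numFieldNormedType.Exports.

Local Open Scope classical_set_scope.
Local Open Scope ring_scope.

(* Let N be P with column j replaced by 0. The event that j is not visited at
   times 1, ..., n belongs to the history up to step n, so the Markov property
   gives P_i(no visit up to n, X_n = k) = (N^n)_ik, and summing the increments
   T_(n+1) - T_n up to the first visit gives m_ij = sum_n (N^n mu)_i.
   Irreducibility makes I - N invertible, so this series is finite and column j
   of M = [m_ij] is (I - N)^-1 mu. With D the diagonal of M and V = M - D, the
   first-step equations read (I - P) V = mu e^T - D; multiplying by pi^T yields
   D pi = lambda e. A g-inverse G then determines V up to a multiple of e in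
   each column, which the zero diagonal of V fixes, and (a) is M pi = V pi + D pi.
   The matrices in (b), (c), (d) are all g-inverses; those in (b) and (d) are
   inverses of rank-one perturbations of I - P. *)

(** * Irreducible stochastic matrices and their taboo matrices *)

Lemma unitmx_ker0 (F : fieldType) (m : nat) (A : 'M[F]_m) :
  (forall x : 'cV_m, A *m x = 0 -> x = 0) -> A \in unitmx.
Proof.
(* [kermx] is a left kernel, whence the transpose. *)
move=> kerA; rewrite -unitmx_tr -row_free_unit -kermx_eq0.
apply/eqP/row_matrixP => i; rewrite row0.
have /(congr1 trmx) : row i (kermx A^T) *m A^T = 0.
  by apply/sub_kermxP; exact: row_sub.
rewrite trmx_mul trmxK trmx0 => /kerA /(congr1 trmx).
by rewrite trmxK trmx0.
Qed.

(** Only column [j] is cleared, not row [j]: paths may start at [j], so return times are covered as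
    well. *)
Definition taboo_mx (R : realType) (m : nat) (P : 'M[R]_m) (j : 'I_m) :
    'M[R]_m :=
  \matrix_(i, k) if k == j then 0 else P i k.

Lemma mulmx_onesE (R : realType) (m : nat) (P : 'M[R]_m) :
  P *m ones = ones -> forall i, \sum_k P i k = 1.
Proof.
move=> Pe i; have /matrixP/(_ i 0) := Pe; rewrite !mxE => <-.
by apply: eq_bigr => k _; rewrite mxE mulr1.
Qed.

Section irreducible_stochastic.
Context {R : realType} {m : nat} (P : 'M[R]_m).
Hypothesis P_ge0 : forall i k, 0 <= P i k.
Hypothesis P_sum1 : P *m ones = ones.
Hypothesis P_irr : irreducible_mx P.

Let Psum := mulmx_onesE P_sum1.

(* The indices where |x| is maximal form a set closed under P that avoids j,
   contradicting irreducibility unless x = 0. *)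
Lemma taboo_mx_fixed0 (j : 'I_m) (x : 'cV[R]_m) :
  taboo_mx P j *m x = x -> x = 0.
Proof.
move=> Nx; pose i0 := [arg max_(i > j) `|x i 0|]%O.
have xmax i : `|x i 0| <= `|x i0 0|.
  by rewrite /i0; case: arg_maxP => // i1 _; apply.
have [x0|xi0] := eqVneq (x i0 0) 0.
  apply/colP => i; apply/eqP; rewrite mxE -normr_le0.
  by apply: le_trans (xmax i) _; rewrite x0 normr0.
have closed i k : `|x i 0| = `|x i0 0| -> 0 < P i k ->
    k != j /\ `|x k 0| = `|x i0 0|.
  (* If [k] failed the claim, its term in the average would lie strictly below its bound, and
     [|x i|] would miss the maximum. *)
  move=> xi Pik; have [//|Nk] := pselect (k != j /\ `|x k 0| = `|x i0 0|).
  suff : `|x i 0| < `|x i0 0| by rewrite xi ltxx.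
  have /matrixP/(_ i 0) := Nx; rewrite mxE => <-.
  apply: le_lt_trans (ler_norm_sum _ _ _) _.
  have -> : `|x i0 0| = \sum_k P i k * `|x i0 0|.
    by rewrite -mulr_suml Psum mul1r.
  have term l : `|taboo_mx P j i l * x l 0| <= P i l * `|x i0 0|.
    rewrite mxE; case: eqP => _; rewrite normrM ?normr0 ?mul0r ?mulr_ge0//.
    by rewrite (ger0_norm (P_ge0 _ _)) ler_wpM2l.
  rewrite (bigD1 k)//= [ltRHS](bigD1 k)//= ltr_leD ?ler_sum//.
  rewrite mxE; case: eqP => [_|/eqP kj].
    by rewrite mul0r normr0 mulr_gt0// normr_gt0.
  rewrite normrM (ger0_norm (P_ge0 _ _)) ltr_pM2l// lt_neqAle xmax andbT.
  by apply/eqP => xk; apply: Nk.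
have noreach n i : `|x i 0| = `|x i0 0| -> i != j -> (P ^+ n) i j = 0.
  elim: n i => [|n IHn] i xi ij; first by rewrite expr0 mxE (negbTE ij).
  rewrite exprS mxE big1// => k _; have [->|Pik] := eqVneq (P i k) 0.
    by rewrite mul0r.
  have [kj xk] : k != j /\ `|x k 0| = `|x i0 0|.
    by apply: closed xi _; rewrite lt_def Pik P_ge0.
  by rewrite IHn// mulr0.
(* [i0] may be [j] itself, but one step of positive probability leads to a maximal index other than
   [j]. *)
have [k Pk] : exists k, 0 < P i0 k.
  apply: contrapT => noP; have /eqP := Psum i0.
  rewrite big1 ?(eq_sym 0) ?oner_eq0// => k _; apply/eqP.
  by apply: contrapT => /negP Pk; apply: noP; exists k; rewrite lt_def Pk P_ge0.
have [kj xk] := closed _ _ erefl Pk.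
by have [n] := P_irr k j; rewrite (noreach n) ?ltxx.
Qed.

Lemma taboo_mx_unit (j : 'I_m) : 1%:M - taboo_mx P j \in unitmx.
Proof.
apply: unitmx_ker0 => x; rewrite mulmxBl mul1mx => /eqP.
by rewrite subr_eq0 => /eqP/esym/taboo_mx_fixed0.
Qed.

Lemma taboo_mx_pow_ge0 (j : 'I_m) n i k : 0 <= (taboo_mx P j ^+ n) i k.
Proof.
elim: n i => [|n IHn] i; first by rewrite expr0 mxE ler0n.
rewrite exprS mxE sumr_ge0// => l _; rewrite mulr_ge0// mxE.
by case: eqP.
Qed.

Lemma taboo_mx_pow_sum_le1 (j : 'I_m) n i : \sum_k (taboo_mx P j ^+ n) i k <= 1.
Proof.
elim: n i => [|n IHn] i.
  rewrite expr0 (bigD1 i)//= big1 => [|k ki]; last first.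
    by rewrite mxE eq_sym (negbTE ki).
  by rewrite mxE eqxx addr0.
under eq_bigr do rewrite exprS mxE.
rewrite exchange_big/= -(Psum i) ler_sum// => l _; rewrite -mulr_sumr.
apply: (@le_trans _ _ (P i l * 1)); last by rewrite mulr1.
apply: ler_pM => //.
- by rewrite mxE; case: eqP.
- by rewrite sumr_ge0// => k _; rewrite taboo_mx_pow_ge0.
- by rewrite mxE; case: eqP.
Qed.

Lemma taboo_mx_geometric (j : 'I_m) (x : 'cV[R]_m) n :
  \sum_(0 <= k < n) taboo_mx P j ^+ k *m x =
  invmx (1%:M - taboo_mx P j) *m (x - taboo_mx P j ^+ n *m x).
Proof.
apply: (canRL (mulKmx (taboo_mx_unit j))).
elim: n => [|n IHn].
  by rewrite big_geq// mulmx0 expr0 mul1mx subrr.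
rewrite big_nat_recr//= mulmxDr IHn mulmxBl mul1mx exprS -mulmxA.
by rewrite addrA subrK.
Qed.

(** The partial sums increase, and the closed form of the geometric sum bounds them because the
    entries of [N^n x] stay below the total of [x]. Hence the terms tend to 0, and so does the
    remainder in the closed form. *)
Lemma cvg_taboo_mx_series (j : 'I_m) (x : 'cV[R]_m) (i : 'I_m) :
    (forall k, 0 <= x k 0) ->
  series (fun n => (taboo_mx P j ^+ n *m x) i 0) @ \oo -->
    (invmx (1%:M - taboo_mx P j) *m x) i 0.
Proof.
move=> x0; set N := taboo_mx P j; set J := invmx _.
pose u l n := (N ^+ n *m x) l 0.
have u0 l n : 0 <= u l n.
  by rewrite /u mxE sumr_ge0// => k _; rewrite mulr_ge0 ?taboo_mx_pow_ge0.
have ule l n : u l n <= \sum_k x k 0.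
  rewrite /u mxE ler_sum// => k _; rewrite ler_piMl//.
  apply: le_trans (taboo_mx_pow_sum_le1 j n l).
  by rewrite (bigD1 k)//= lerDl sumr_ge0// => ? _; rewrite taboo_mx_pow_ge0.
have seriesE l n : series (u l) n = (J *m x) l 0 - \sum_k J l k * u k n.
  have := taboo_mx_geometric j x n; rewrite -/N -/J => /matrixP/(_ l 0).
  rewrite mulmxBr summxE [RHS]mxE /series /u /= => ->; congr (_ + _).
  by rewrite !mxE.
have cvgu l : u l @ \oo --> 0.
  apply: cvg_series_cvg_0; apply: nondecreasing_is_cvgn.
    exact: nondecreasing_series.
  exists ((J *m x) l 0 + \sum_k `|J l k| * \sum_k x k 0) => _ [n _ <-].
  rewrite seriesE lerD2l -sumrN ler_sum// => k _.
  rewrite (le_trans (ler_norm _))// normrN normrM (ger0_norm (u0 _ _)).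
  by rewrite ler_wpM2l.
rewrite (_ : series _ = fun n => (J *m x) i 0 - \sum_k J i k * u k n);
  last first.
  by apply/funext => n; rewrite -seriesE.
rewrite -[X in _ --> X]subr0; apply: cvgB; first exact: cvg_cst.
rewrite [X in _ --> X](_ : _ = \sum_k J i k * 0); last first.
  by rewrite big1// => k _; rewrite mulr0.
apply: cvg_big => [|k _]; first exact: add_continuous.
by apply: cvgMl_tmp; exact: cvgu.
Qed.

(** [x - x j 0 *: ones] vanishes at [j], so [P] acts on it as the taboo matrix does, which has no
    nonzero fixed vector. *)
Lemma ker_one_minus (x : 'cV[R]_m) (j : 'I_m) :
  (1%:M - P) *m x = 0 -> x = x j 0 *: ones.
Proof.
move=> Ax; have Ay : (1%:M - P) *m (x - x j 0 *: ones) = 0.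
  by rewrite mulmxBr Ax -scalemxAr mulmxBl mul1mx P_sum1 subrr scaler0 subr0.
apply/eqP; rewrite -subr_eq0; apply/eqP/(@taboo_mx_fixed0 j).
move: Ay; set y := x - _ => /eqP; rewrite mulmxBl mul1mx subr_eq0 => /eqP yP.
rewrite [RHS]yP; apply/colP => i; rewrite !mxE; apply: eq_bigr => k _.
by rewrite mxE; case: eqP => // ->; rewrite /y !mxE mulr1 subrr !mulr0.
Qed.

(** * Stationary vector and rank-one perturbations of [I - P] *)

Context (p : 'cV[R]_m).
Hypothesis p_stat : p^T *m P = p^T.
Hypothesis p_sum1 : p^T *m ones = 1%:M.

Let A := 1%:M - P.

Let A_ones : A *m ones = 0.
Proof. by rewrite mulmxBl mul1mx P_sum1 subrr. Qed.

Let p_A : p^T *m A = 0.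
Proof. by rewrite mulmxBr mulmx1 p_stat subrr. Qed.

(** Applying [p^T] to [W x = 0] leaves [s (b^T x) = 0]; then [A x = 0], so [x] is a multiple of
    [ones], and [t != 0] makes it zero. *)
Lemma rank1_perturbation_unit (a b : 'cV[R]_m) (s t : R) :
    p^T *m a = s%:M -> s != 0 -> b^T *m ones = t%:M -> t != 0 ->
  A + a *m b^T \in unitmx.
Proof.
move=> pa s0 be t0; apply: unitmx_ker0 => x; rewrite mulmxDl => Wx.
have bx : b^T *m x = 0.
  have : p^T *m (A *m x + a *m b^T *m x) = 0 by rewrite Wx mulmx0.
  rewrite mulmxDr !mulmxA p_A mul0mx add0r pa mul_scalar_mx => /eqP.
  by rewrite -scalemxAl scaler_eq0 (negbTE s0) => /eqP.
have Ax : A *m x = 0 by move: Wx; rewrite -mulmxA bx mulmx0 addr0.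
have [j|noj] := pickP 'I_m; last by apply/colP => i; have := noj i.
move=> _; have xj := ker_one_minus j Ax.
move: bx; rewrite {1}xj -scalemxAr be => /matrixP/(_ 0 0)/eqP.
rewrite !mxE mulr1n mulf_eq0 (negbTE t0) orbF => /eqP xj0.
by rewrite xj xj0 scale0r.
Qed.

(** [W] sends [ones] to [t a], and [p^T W = s b^T]. Hence [A W^-1 = I - s^-1 a p^T], and [p^T A = 0]
    finishes. *)
Lemma rank1_perturbation_g_inverse (a b : 'cV[R]_m) (s t : R) :
    p^T *m a = s%:M -> s != 0 -> b^T *m ones = t%:M -> t != 0 ->
  g_inverse A (invmx (A + a *m b^T)) /\
  invmx (A + a *m b^T) *m a = t^-1 *: ones.
Proof.
move=> pa s0 be t0; have Wu := rank1_perturbation_unit pa s0 be t0.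
set W := A + a *m b^T in Wu *.
have Wa : invmx W *m a = t^-1 *: ones.
  rewrite -[ones](mulKmx Wu) [RHS]scalemxAr; congr (_ *m _).
  rewrite mulmxDl A_ones add0r -mulmxA be mul_mx_scalar scalerA mulVf//.
  by rewrite scale1r.
have bW : b^T *m invmx W = s^-1 *: p^T.
  rewrite -[p^T](mulmxK Wu) scalemxAl; congr (_ *m _).
  rewrite mulmxDr p_A add0r mulmxA pa mul_scalar_mx scalerA mulVf//.
  by rewrite scale1r.
split=> //; rewrite /g_inverse.
have -> : A *m invmx W = 1%:M - a *m (b^T *m invmx W).
  by rewrite -(mulmxV Wu) mulmxA -mulmxBl addrK.
by rewrite bW mulmxBl mul1mx -mulmxA -scalemxAl p_A scaler0 mulmx0 subr0.
Qed.

(** * Mean first passage matrix in terms of a g-inverse *)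

Context (mu : 'cV[R]_m) (lambda : R).
Hypothesis lambdaE : p^T *m mu = lambda%:M.

(* Because column j of the taboo matrix vanishes, column j solves the first-step
   equation
   m_ij = mu_i + \sum_(k | k != j) p_ik m_kj. *)
Definition first_passage_mx : 'M[R]_m :=
  \matrix_(i, j) (invmx (1%:M - taboo_mx P j) *m mu) i 0.

Let d : 'rV[R]_m := \row_j first_passage_mx j j.
Let V := first_passage_mx - diag_mx d.

(** The first-step equations: as [V] has zero diagonal, column [j] of [P V] is the taboo matrix of
    [j] applied to column [j] of [first_passage_mx]. *)
Let A_V : A *m V = mu *m ones^T - diag_mx d.
Proof.
apply/matrixP => i j.
have VE k : V k j = if k == j then 0 else first_passage_mx k j.
  rewrite !mxE; case: eqP => [->|_]; first by rewrite mulr1n subrr.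
  by rewrite mulr0n subr0.
have Mj : first_passage_mx i j - \sum_k P i k * V k j = mu i 0.
  have := mulKVmx (taboo_mx_unit j) mu.
  move=> /matrixP/(_ i 0) <-; rewrite mulmxBl mul1mx !mxE; congr (_ - _).
  apply: eq_bigr => k _; rewrite VE !mxE.
  by case: eqP => _; rewrite ?mulr0 ?mul0r// !mxE.
have -> : (A *m V) i j = V i j - \sum_k P i k * V k j.
  by rewrite mulmxBl mul1mx mxE; congr (_ + _); rewrite !mxE.
have -> : V i j = first_passage_mx i j - diag_mx d i j.
  by rewrite [LHS]mxE; congr (_ + _); rewrite mxE.
rewrite addrAC Mj [RHS]mxE; congr (_ + _); last by rewrite [RHS]mxE.
by rewrite mxE big_ord1 !mxE mulr1.
Qed.

(** Entrywise the mean return time formula [p_j m_jj = lambda], obtained by multiplying [A_V] by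
    [p^T] on the left. *)
Let diag_d_p : diag_mx d *m p = lambda *: ones.
Proof.
have := congr1 (mulmx p^T) A_V.
rewrite mulmxA p_A mul0mx mulmxBr mulmxA lambdaE.
move=> /esym/eqP; rewrite subr_eq0 => /eqP/(congr1 trmx).
rewrite mul_scalar_mx !trmx_mul trmxK tr_diag_mx => <-.
by rewrite linearZ/= trmxK.
Qed.

Lemma g_inverse_first_passage_mx (G : 'M[R]_m) : g_inverse A G ->
  first_passage_mx *m p =
  G *m mu - \tr (G *m mu *m p^T) *: ones + lambda *: ones
    - lambda *: (G *m ones) + (lambda * \tr G) *: ones.
Proof.
move=> AGA; set B := mu *m ones^T - diag_mx d.
have VB j : col j V = col j (G *m B) - (G *m B) j j *: ones.
  (* Since [B = A V], one has [A G B = A G A V = A V]. *)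
  have : A *m (col j V - col j (G *m B)) = 0.
    rewrite !colE -mulmxBl mulmxA mulmxBr.
    by rewrite /B -A_V !mulmxA AGA subrr mul0mx.
  move=> /(ker_one_minus j) /eqP; rewrite subr_eq => /eqP ->.
  rewrite addrC; congr (_ + _); rewrite -scaleNr; congr (_ *: _).
  by rewrite !mxE eqxx mulr1n subrr add0r.
have -> : first_passage_mx = V + diag_mx d by rewrite subrK.
have -> : V = G *m B - ones *m (\row_j (G *m B) j j).
  apply/matrixP => i j; have /matrixP/(_ i 0) := VB j.
  by rewrite !mxE big_ord1 !mxE mulr1 mul1r.
have ones_p : ones^T *m p = 1%:M.
  by apply/trmx_inj; rewrite trmx_mul trmxK p_sum1 trmx1.
rewrite mulmxDl diag_d_p mulmxBl -(mulmxA ones).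
(* Here [(G B)_jj = (G mu)_j - G_jj d_j], and [d_j p_j = lambda] turns the last part into
   [lambda * \tr G]. *)
have -> : (\row_j (G *m B) j j) *m p =
    (\tr (G *m mu *m p^T) - lambda * \tr G)%:M.
  apply/matrixP => i0 j0; rewrite !ord1 [LHS]mxE [RHS]mxE eqxx mulr1n.
  rewrite /mxtrace mulr_sumr -sumrB; apply: eq_bigr => j _.
  have /matrixP/(_ j 0) := diag_d_p.
  rewrite mul_diag_mx [LHS]mxE [RHS]mxE [ones _ _]mxE mulr1 => <-.
  have GBj : (G *m B) j j = (G *m mu) j 0 - G j j * d 0 j.
    rewrite mulmxBr mulmxA mxE; congr (_ + _).
      by rewrite mxE big_ord1 [ones^T _ _]mxE [ones _ _]mxE mulr1.
    by rewrite mxE mul_mx_diag [in LHS]mxE.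
  have Gmup : (G *m mu *m p^T) j j = (G *m mu) j 0 * p j 0.
    by rewrite mxE big_ord1 [p^T _ _]mxE.
  by rewrite [X in X * _]mxE GBj Gmup; ring.
rewrite -(mulmxA G B) [B *m p]mulmxBl -(mulmxA mu) diag_d_p ones_p mulmx1
  mul_mx_scalar mulmxBr -scalemxAr.
rewrite scalerBl opprB; apply/matrixP => i j; rewrite !mxE; ring.
Qed.

End irreducible_stochastic.

(** * Stieltjes integrals and splitting along a finite-valued variable *)

Lemma ge0_integral_mrestr d (T : measurableType d) (R : realType)
    (mu : {measure set T -> \bar R}) (D : set T) (mD : measurable D)
    (f : T -> \bar R) :
    measurable_fun setT f -> (forall x, (0 <= f x)%E) ->
  (\int[mrestr mu mD]_x f x = \int[mu]_(x in D) f x)%E.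
Proof.
move=> mf f0.
rewrite (@ge0_negligible_integral _ _ _ _ setT (~` D))//; last 2 first.
- exact: measurableC.
- by rewrite /= /mrestr setICl measure0.
rewrite setDE setCK setTI; apply: eq_measure_integral => A mA AD.
by rewrite /= /mrestr setIidl.
Qed.

Lemma stieltjes_measure_itv (R : realType) (F : cumulative R R) (a b : R) :
  a <= b -> lebesgue_stieltjes_measure F `]a, b]%classic = (F b - F a)%:E.
Proof.
move=> ab; rewrite /lebesgue_stieltjes_measure /measure_extension/=.
by rewrite measurable_mu_extE/= ?wlength_itv_bnd//; exact: is_ocitv.
Qed.

(** Half-open intervals form a pi-system generating the Borel sets, and the intervals []-k, k]]
    exhaust the line with finite measure. *)
Lemma stieltjes_measure_scale_unique (R : realType) (F : cumulative R R)
    (c : {nonneg R}) (nu : {measure set (measurableTypeR R) -> \bar R}) :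
    (forall a b, a <= b -> nu `]a, b]%classic = (c%:num * (F b - F a))%:E) ->
  forall A, measurable A -> nu A = mscale c (lebesgue_stieltjes_measure F) A.
Proof.
move=> nuE; apply: (@measure_unique _ R (measurableTypeR R) (@ocitv R)
  (fun k => `](- k%:R), k%:R]%classic)).
- by [].
- exact: ocitvI.
- by move=> k; exact: is_ocitv.
- rewrite -subTset => /= x _ /=.
  exists (Num.bound `|x|) => //=; rewrite in_itv/=.
  by have := archi_boundP (normr_ge0 x); rewrite ltr_norml => /andP[-> /ltW ->].
- move=> _ /= [[a b] _ <-] /=; rewrite /mscale.
  have [ab|ba] := leP a b; last first.
    by rewrite set_itv_ge ?bnd_simp -?leNgt ?(ltW ba)// !measure0 mule0.
  rewrite nuE// EFinM; congr (_ * _)%E.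
  exact/esym/stieltjes_measure_itv.
- by move=> k; rewrite nuE ?ltry// (@le_trans _ _ 0) ?oppr_le0.
Qed.

(** The image under [f] of [mu] restricted to [E] has distribution function [c F], hence is [c]
    times the Stieltjes measure of [F]; the rest is a change of variables. *)
Lemma ge0_integral_stieltjes d (T : measurableType d) (R : realType)
    (mu : {measure set T -> \bar R}) (E : set T) (f : T -> R)
    (F : cumulative R R) (c : R) :
    measurable E -> measurable_fun setT f -> (forall x, 0 <= f x) -> 0 <= c ->
    (forall t, mu (E `&` [set x | f x <= t]) = (c * F t)%:E) ->
  (\int[mu]_(x in E) (f x)%:E =
   c%:E * \int[lebesgue_stieltjes_measure F]_(t in `[0%R, +oo[) t%:E)%E.
Proof.
move=> mE mf f0 c0 cdf.
have mfle t : measurable [set x | f x <= t].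
  by rewrite -[X in measurable X]setTI; exact: measurable_fun_le.
pose nu := pushforward (mrestr mu mE) (f : T -> measurableTypeR R).
have nuE A : measurable A ->
    nu A = mscale (NngNum c0) (lebesgue_stieltjes_measure F) A.
  apply: stieltjes_measure_scale_unique => a b ab.
  change (mu (f @^-1` `]a, b]%classic `&` E) = (c * (F b - F a))%:E).
  rewrite (_ : _ `&` E =
    (E `&` [set x | f x <= b]) `\` (E `&` [set x | f x <= a])).
    rewrite measureD; last 3 first.
    - exact: measurableI.
    - exact: measurableI.
    - by apply: le_lt_trans (ltry (c * F b)); rewrite -cdf.
    rewrite mulrBr EFinB; congr (_ - _)%E; first exact: cdf.
    rewrite -cdf; congr (mu _).
    apply/setIidr => x [Ex /= xa]; split => //=; exact: le_trans ab.
  apply/seteqP; split => x /=; rewrite in_itv/=.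
    move=> [/andP[ax xb] Ex]; split => // -[_]; apply/negP.
    by rewrite -ltNge.
  move=> [[Ex xb] /not_andP[//|/negP]]; rewrite -ltNge => ax.
  by split => //; apply/andP.
transitivity (\int[nu]_(t in `[0%R, +oo[) t%:E)%E.
  rewrite /nu [RHS]ge0_integral_pushforward//.
  (* As [f >= 0], the preimage of [[0, +oo[] is the whole space. *)
  - rewrite (_ : _ @^-1` _ = setT).
      apply/esym/(@ge0_integral_mrestr _ _ _ mu E mE (EFin \o f)) => [|x].
        exact/measurable_EFinP.
      by rewrite lee_fin.
    by apply/seteqP; split => x //= _; rewrite in_itv/= f0.
  - by move=> t; rewrite inE/= in_itv/= andbT lee_fin.
rewrite (@eq_measure_integral _ _ _ _
  (mscale (NngNum c0) (lebesgue_stieltjes_measure F))).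
  rewrite ge0_integral_mscale//.
  by move=> t /=; rewrite in_itv/= andbT lee_fin.
by move=> A mA _; exact: nuE.
Qed.

Lemma setI_fibers (T : Type) (m : nat) (Y : T -> 'I_m) (A : set T) :
  A = \big[setU/set0]_(l < m) (A `&` [set x | Y x = l]).
Proof.
rewrite -bigcup_seq; apply/seteqP; split => [x Ax|x [l _ []]//].
by exists (Y x) => //=; rewrite mem_index_enum.
Qed.

Lemma trivIset_fibers (T : Type) (m : nat) (Y : T -> 'I_m) (A : set T)
    (D : set 'I_m) :
  trivIset D (fun l => A `&` [set x | Y x = l]).
Proof. by move=> i j _ _ [x [[_ /= <-] [_ /= <-]]]. Qed.

Lemma measure_fibers d (T : measurableType d) (R : realType) (m : nat)
    (mu : {measure set T -> \bar R}) (Y : T -> 'I_m) (A : set T) :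
    measurable A -> (forall l, measurable [set x | Y x = l]) ->
  (mu A = \sum_(l < m) mu (A `&` [set x | Y x = l]))%E.
Proof.
move=> mA mY; rewrite {1}(setI_fibers Y A) measure_bigsetU_ord//.
  by move=> l; exact: measurableI.
exact: trivIset_fibers.
Qed.

Lemma ge0_integral_fibers d (T : measurableType d) (R : realType) (m : nat)
    (mu : {measure set T -> \bar R}) (Y : T -> 'I_m) (A : set T)
    (f : T -> \bar R) :
    measurable A -> (forall l, measurable [set x | Y x = l]) ->
    measurable_fun setT f -> (forall x, (0 <= f x)%E) ->
  (\int[mu]_(x in A) f x =
   \sum_(l < m) \int[mu]_(x in A `&` [set x | Y x = l]) f x)%E.
Proof.
move=> mA mY mf f0; rewrite {1}(setI_fibers Y A) ge0_integral_bigsetU//.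
- by move=> l; exact: measurableI.
- exact: index_enum_uniq.
- exact: trivIset_fibers.
- exact: measurable_funTS.
Qed.

(** * Taboo events and one-step laws of the process *)

(** Time 0 is left out, since a passage counts only from [r >= 1]. *)
Definition unvisited (Omega : Type) (m : nat) (X : nat -> Omega -> 'I_m)
    (j : 'I_m) (n : nat) : set Omega :=
  [set w | forall r, (0 < r <= n)%N -> X r w != j].

Section unvisited.
Context (Omega : Type) (m : nat) (X : nat -> Omega -> 'I_m) (j : 'I_m).

Lemma unvisited0 : unvisited X j 0 = setT.
Proof. by apply/seteqP; split => // w _ [|r]. Qed.

Lemma unvisitedS n :
  unvisited X j n.+1 = unvisited X j n `&` X n.+1 @^-1` [set~ j].
Proof.
apply/seteqP; split => [w Uw|w [Uw /eqP Xw] r /andP[r0]].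
  split; last by apply/eqP/Uw; rewrite leqnn.
  by move=> r /andP[r0 rn]; apply: Uw; rewrite r0 ltnW.
by rewrite leq_eqVlt => /predU1P[->//|rn]; apply: Uw; rewrite r0.
Qed.

End unvisited.

Section markov_renewal_process.
Context {d : measure_display} {Omega : measurableType d} {R : realType}
  {m : nat} (P : probability Omega R) (X : nat -> Omega -> 'I_m)
  (T : nat -> Omega -> R) (Q : 'I_m -> 'I_m -> cumulative R R).
Hypothesis mrp : markov_renewal P X T Q.

Let mX n l : measurable [set w | X n w = l] := mr_measurable_X mrp n l.

(** The generators are measurable; for [X k] because ['I_m] is finite, so that a preimage is a
    finite union of fibers. *)
Lemma history_measurable n A : history X T n A -> measurable A.
Proof.
apply: smallest_sub; first exact: sigma_algebra_measurable.
move=> _ [k _ [[B ->]|[B mB ->]]]; last first.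
  by rewrite -[X in measurable X]setTI; exact: (mr_measurable_T mrp).
rewrite (setI_fibers (X k) (X k @^-1` B)); apply: bigsetU_measurable => l _.
have [Bl|Bl] := pselect (B l).
  rewrite (_ : _ `&` _ = [set w | X k w = l])//.
  by apply/setIidr => w /= ->.
by rewrite (_ : _ `&` _ = set0)// -subset0 => w [/= + Xl]; rewrite Xl.
Qed.

Lemma history_unvisited j n : history X T n (unvisited X j n).
Proof.
(* The induction runs on the event while the sigma-algebra stays fixed at step [n]. *)
suff : forall k, (k <= n)%N -> history X T n (unvisited X j k).
  by move=> /(_ n (leqnn n)).
elim=> [_|k IHk kn].
  rewrite unvisited0; exact: (@measurableT _ (g_sigma_algebraType _)).
have hX : history X T n (X k.+1 @^-1` [set~ j]).
  by apply: sub_sigma_algebra; exists k.+1 => //; left; exists [set~ j].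
rewrite unvisitedS.
exact: (@measurableI _ (g_sigma_algebraType _) _ _ (IHk (ltnW kn)) hX).
Qed.

Let dT n : Omega -> R := fun w => T n.+1 w - T n w.

Let mdT n : measurable_fun setT (dT n).
Proof. by apply: measurable_funB; exact: mr_measurable_T mrp _. Qed.

Let dT_ge0 n w : 0 <= dT n w.
Proof. by rewrite subr_ge0; exact: mr_T_mono mrp _ _. Qed.

Lemma increment_cdf n A i j t : history X T n A ->
  P (A `&` [set w | X n w = i] `&` [set w | X n.+1 w = j] `&`
       [set w | dT n w <= t]) =
  (fine (P (A `&` [set w | X n w = i])) * Q i j t)%:E.
Proof.
move=> hA; have mA := history_measurable hA.
rewrite EFinM fineK ?fin_num_measure//; last exact: measurableI.
by rewrite -(mr_markov mrp) // -setIA.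
Qed.

Lemma integral_increment n A i j : history X T n A ->
  (\int[P]_(w in A `&` [set w | X n w = i] `&` [set w | X n.+1 w = j])
      (T n.+1 w - T n w)%:E =
   P (A `&` [set w | X n w = i]) * mean_sojourn_to Q i j)%E.
Proof.
move=> hA; have mA := history_measurable hA.
rewrite (@ge0_integral_stieltjes _ _ _ _ _ (dT n) (Q i j)
  (fine (P (A `&` [set w | X n w = i]))))//.
- by rewrite fineK// fin_num_measure//; exact: measurableI.
- by apply: measurableI => //; exact: measurableI.
- by rewrite fine_ge0.
- by move=> t; exact: increment_cdf.
Qed.

(** The Markov property as [t] tends to infinity along the integers, by continuity of the measure
    from below. *)
Lemma measure_transition n A i j : history X T n A ->
  P (A `&` [set w | X n w = i] `&` [set w | X n.+1 w = j]) =
  (P (A `&` [set w | X n w = i]) * (trans_mx Q i j)%:E)%E.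
Proof.
move=> hA; have mA := history_measurable hA.
have mAi : measurable (A `&` [set w | X n w = i]) by exact: measurableI.
have mE : measurable (A `&` [set w | X n w = i] `&` [set w | X n.+1 w = j]).
  exact: measurableI.
set c := fine (P (A `&` [set w | X n w = i])).
have cE : P (A `&` [set w | X n w = i]) = c%:E.
  by rewrite fineK// fin_num_measure.
(* A null event is treated apart: existence of the limit of [Q i j] is deduced below from the bound
   [Q i j t <= c^-1], which needs [c > 0]. *)
have [c0|c0] := eqVneq c 0.
  rewrite cE c0 mul0e.
  apply: (@subset_measure0 _ _ _ P _ (A `&` [set w | X n w = i])) => //.
  by move: cE; rewrite c0.
have cgt0 : 0 < c by rewrite lt_def c0 fine_ge0.
have mfle t : measurable [set w | dT n w <= t].
  by rewrite -[Y in measurable Y]setTI; exact: measurable_fun_le.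
pose E t := A `&` [set w | X n w = i] `&` [set w | X n.+1 w = j] `&`
       [set w | dT n w <= t].
have mEt t : measurable (E t) by exact: measurableI.
have PE t : P (E t) = (c * Q i j t)%:E by exact: increment_cdf.
have Qcvg : Q i j t @[t --> +oo] --> trans_mx Q i j.
  rewrite mxE; apply/cvg_ex; exists (sup (range (Q i j))).
  apply: nondecreasing_cvgr; first exact: cumulative_is_nondecreasing.
  exists c^-1 => _ [t _ <-]; rewrite -[leRHS]mulr1 ler_pdivlMl//.
  by rewrite -lee_fin -PE probability_le1.
rewrite cE -EFinM.
have Ecvg : P (E k%:R) @[k --> \oo] --> P (\bigcup_k E k%:R).
  apply: (nondecreasing_cvg_mu (F := fun k => E k%:R)) => //.
    exact: bigcup_measurable.
  move=> k l kl; apply/subsetPset => w [Ew /= wk]; split => //=.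
  by rewrite (le_trans wk)// ler_nat.
have UE : \bigcup_k E k%:R =
    A `&` [set w | X n w = i] `&` [set w | X n.+1 w = j].
  apply/seteqP; split => [w [k _ []]//|w Ew].
  exists (Num.bound (dT n w)) => //; split => //=.
  exact/ltW/archi_boundP.
rewrite -UE; apply: (cvg_unique _ Ecvg) => //=.
under eq_cvg do rewrite PE.
apply: cvg_EFin; first by apply: nearW.
apply: cvgMl_tmp; move/cvg_pinftyP : Qcvg; apply; exact: cvgr_idn.
Qed.

End markov_renewal_process.

(** * First passage times *)

(** If the first visit is at step [r], the increments kept are exactly those with [n < r], and they
    telescope to [T r]. Without a visit the series may still be finite, so [+oo] is added on that
    event. *)
Lemma first_passage_series (Omega : Type) (R : realType) (m : nat)
    (X : nat -> Omega -> 'I_m) (T : nat -> Omega -> R) (j : 'I_m) (w : Omega) :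
    T 0%N w = 0 -> (forall n, T n w <= T n.+1 w) ->
  (first_passage X T j w =
   \sum_(n <oo) ((fun v => (T n.+1 v - T n v)%:E) \_ (unvisited X j n)) w
     + (cst +oo \_ (\bigcap_n unvisited X j n)) w)%E.
Proof.
move=> T0 Tnd; rewrite /first_passage.
have g0 n : (0 <= ((fun v => (T n.+1 v - T n v)%:E) \_ (unvisited X j n)) w)%E.
  by rewrite patchE; case: ifP => // _; rewrite lee_fin subr_ge0.
case: pselect => [visited|unv]; last first.
  rewrite [(cst _ \_ _) w]patchE mem_set ?addey//.
    by rewrite gt_eqF// (lt_le_trans (ltNy0))//; exact: nneseries_ge0.
  move=> n _ r /andP[r0 _]; apply/negP => Xr; apply: unv.
  by exists r; rewrite r0.
case: ex_minnP => r /andP[r0 Xr] rmin.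
rewrite [(cst _ \_ _) w]patchE memNset ?adde0; last first.
  by move=> /(_ r Logic.I r); rewrite r0 leqnn => /(_ isT); rewrite Xr.
rewrite (nneseries_split 0 r)// add0n eseries0 ?adde0; last first.
  move=> n rn _; rewrite patchE memNset// => /(_ r).
  by rewrite r0 rn => /(_ isT); rewrite Xr.
have -> : T r w = \sum_(0 <= k < r) (T k.+1 w - T k w).
  by rewrite telescope_sumr// T0 subr0.
rewrite -sumEFin; apply: eq_big_nat => k kr.
rewrite patchE mem_set// => s /andP[s0 sk]; apply/negP => Xs.
have := rmin s; rewrite s0 Xs leqNgt => /(_ isT)/negP; apply.
exact: leq_ltn_trans kr.
Qed.

Section first_passage_time.
Context {d : measure_display} {Omega : measurableType d} {R : realType}
  {m : nat} (P : probability Omega R) (X : nat -> Omega -> 'I_m)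
  (T : nat -> Omega -> R) (Q : 'I_m -> 'I_m -> cumulative R R).
Hypothesis mrp : markov_renewal P X T Q.
Context (i : 'I_m).
Hypothesis start : P [set w | X 0%N w = i] = 1%E.

Let mX n l : measurable [set w | X n w = l] := mr_measurable_X mrp n l.

Let trans_mxE l :
  P ([set w | X 0%N w = i] `&` [set w | X 1%N w = l]) = (trans_mx Q i l)%:E.
Proof.
have hT : history X T 0 setT.
  by rewrite -(unvisited0 X i); exact: history_unvisited.
by have := measure_transition mrp i l hT; rewrite setTI start mul1e.
Qed.

Lemma trans_mx_ge0 l : 0 <= trans_mx Q i l.
Proof. by rewrite -lee_fin -trans_mxE. Qed.

Lemma trans_mx_sum1 : \sum_l trans_mx Q i l = 1.
Proof.
apply: EFin_inj; rewrite -sumEFin -start.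
rewrite (measure_fibers P (Y := X 1%N) (mX 0 i))//.
by apply: eq_bigr => l _; exact/esym/trans_mxE.
Qed.

Context (j : 'I_m).
Let N := taboo_mx (trans_mx Q) j.
Let U := unvisited X j.

Let mU n : measurable (U n).
Proof. apply: (history_measurable mrp (n := n)); exact: history_unvisited. Qed.

(** Induction on the last step. For [k = j] both sides vanish; otherwise the restriction at time
    [n.+1] is automatic, and splitting over [X n] gives the product with [N]. *)
Lemma measure_unvisited_state n k :
  P (U n `&` [set w | X n w = k]) = ((N ^+ n) i k)%:E.
Proof.
elim: n k => [|n IHn] k.
  rewrite /U unvisited0 setTI expr0 mxE; case: eqVneq => [<-//|ik].
  have Pi0 : P (~` [set w | X 0%N w = i]) = 0%E.
    by rewrite probability_setC// start subee.
  apply: subset_measure0 Pi0 => //.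
  - exact: measurableC.
  - by move=> w /= ->; apply/eqP; rewrite eq_sym.
rewrite exprSr mxE; have [->|kj] := eqVneq k j.
  rewrite big1 => [|l _]; last by rewrite mxE eqxx mulr0.
  rewrite (_ : _ `&` _ = set0) ?measure0// -subset0 => w [/(_ n.+1)].
  by rewrite leqnn => /(_ isT)/eqP.
have -> : U n.+1 `&` [set w | X n.+1 w = k] = U n `&` [set w | X n.+1 w = k].
  rewrite /U unvisitedS -setIA; congr (_ `&` _); apply/setIidr => w /= ->.
  by apply/eqP.
rewrite (measure_fibers P (Y := X n))//; last exact: measurableI.
rewrite -sumEFin; apply: eq_bigr => l _.
rewrite setIAC; apply: etrans (measure_transition mrp l k _) _.
  exact: history_unvisited.
by rewrite EFinM IHn [N _ _]mxE (negbTE kj).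
Qed.

Lemma measure_unvisited n : P (U n) = ((N ^+ n *m ones) i 0)%:E.
Proof.
rewrite (measure_fibers P (Y := X n) (mU n))//.
rewrite mxE -sumEFin; apply: eq_bigr => k _.
by rewrite [ones _ _]mxE mulr1; exact: measure_unvisited_state.
Qed.

Hypothesis mean_fin : forall k l, mean_sojourn_to Q k l \is a fin_num.

Let mdT n : measurable_fun setT (fun w => (T n.+1 w - T n w)%:E).
Proof.
by apply/measurable_EFinP/measurable_funB; exact: mr_measurable_T mrp _.
Qed.

Let dT_ge0 n w : (0 <= (T n.+1 w - T n w)%:E)%E.
Proof. by rewrite lee_fin subr_ge0; exact: mr_T_mono mrp _ _. Qed.

Lemma integral_unvisited_increment n :
  (\int[P]_(w in U n) (T n.+1 w - T n w)%:E =
   ((N ^+ n *m mean_sojourn Q) i 0)%:E)%E.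
Proof.
rewrite (ge0_integral_fibers P (Y := X n) (mU n))//.
rewrite mxE -sumEFin; apply: eq_bigr => k _.
rewrite (ge0_integral_fibers P (Y := X n.+1))//; last exact: measurableI.
rewrite mxE mulr_sumr -sumEFin; apply: eq_bigr => l _.
apply: etrans (integral_increment mrp k l _) _; first exact: history_unvisited.
by rewrite EFinM fineK// -measure_unvisited_state.
Qed.

(** The start at [i] has given only row [i]; nonnegativity and unit sums of all rows come from the
    whole family of starting laws. *)
Hypothesis P_ge0 : forall k l, 0 <= trans_mx Q k l.
Hypothesis P_sum1 : trans_mx Q *m ones = ones.
Hypothesis P_irr : irreducible_mx (trans_mx Q).

Let mean_sojourn_ge0 k : 0 <= mean_sojourn Q k 0.
Proof.
rewrite mxE sumr_ge0// => l _; apply: fine_ge0; apply: integral_ge0 => t /=.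
by rewrite in_itv/= andbT lee_fin.
Qed.

(** The probabilities of [U n] are the terms of the convergent series of [N^n ones], hence tend to
    0, and each of them bounds that of the intersection. *)
Lemma never_visited_eq0 : P (\bigcap_n U n) = 0%E.
Proof.
have N0 : (N ^+ n *m ones) i 0 @[n --> \oo] --> 0.
  apply: cvg_series_cvg_0; apply/cvg_ex.
  exists ((invmx (1%:M - N) *m ones) i 0).
  by apply: cvg_taboo_mx_series => // k; rewrite mxE.
apply/eqP; rewrite eq_le measure_ge0 andbT.
have /cvg_lim <- // : P (U n) @[n --> \oo] --> 0%E.
  under eq_cvg do rewrite measure_unvisited.
  by apply: cvg_EFin => //; exact: nearW.
apply: lime_ge.
  apply/cvg_ex; exists 0%E; under eq_cvg do rewrite measure_unvisited.
  by apply: cvg_EFin => //; exact: nearW.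
apply: nearW => n; apply: le_measure; rewrite ?inE//.
  exact: bigcap_measurable.
exact: bigcap_inf.
Qed.

(** [first_passage_series] is integrated term by term, all terms being nonnegative; the resulting
    series sums to [(I - N)^-1 mu]. *)
Lemma mean_first_passageE :
  (\int[P]_w first_passage X T j w =
   (first_passage_mx (trans_mx Q) (mean_sojourn Q) i j)%:E)%E.
Proof.
under eq_integral => w _.
  rewrite first_passage_series; [|exact: mr_T0 mrp w|]; last first.
    by move=> n; exact: mr_T_mono mrp n w.
  over.
have mpatch n : measurable_fun setT
    ((fun v => (T n.+1 v - T n v)%:E) \_ (U n)).
  apply/(measurable_restrictT _ (mU n)).1; exact/measurable_funTS/mdT.
have patch_ge0 n w :
    (0 <= ((fun v => (T n.+1 v - T n v)%:E) \_ (U n)) w)%E.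
  by apply: erestrict_ge0 => v _; exact: dT_ge0.
have mnever : measurable (\bigcap_n U n) by exact: bigcap_measurable.
(* The value [+oo] is harmless on a null set, by the convention [+oo * 0 = 0]. *)
have never0 : (\int[P]_w (cst +oo \_ (\bigcap_n U n)) w = 0)%E.
  transitivity (+oo * P (\bigcap_n U n))%E.
    by rewrite -integral_mkcond integral_cst.
  by rewrite never_visited_eq0 mule0.
rewrite ge0_integralD//=.
- rewrite never0 adde0 integral_nneseries//.
  under eq_eseriesr do rewrite -integral_mkcond integral_unvisited_increment.
  have := @cvg_taboo_mx_series _ _ _ P_ge0 P_sum1 P_irr j _ i mean_sojourn_ge0.
  rewrite [first_passage_mx _ _ _ _]mxE => cvgN; apply/cvg_lim => //.
  under eq_cvg do rewrite sumEFin.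
  by apply: cvg_EFin; [exact: nearW|exact: cvgN].
- by move=> w _; exact: nneseries_ge0.
- apply: (ge0_emeasurable_sum (P := xpredT)) => [n w _ _|n _].
    exact: patch_ge0.
  exact: mpatch.
- by move=> w _; rewrite patchE; case: ifP => // _; exact: leey.
- by apply/(measurable_restrictT _ mnever).1; exact: measurable_cst.
Qed.

End first_passage_time.

(** * Assembling the four formulas *)

Theorem theorem1 (R : realType) (m : nat) (d : measure_display)
    (Omega : measurableType d) (Pr : 'I_m -> probability Omega R)
    (X : nat -> Omega -> 'I_m) (T : nat -> Omega -> R)
    (Q : 'I_m -> 'I_m -> cumulative R R)
    (hMRP : forall i, markov_renewal (Pr i) X T Q)
    (hstart : forall i, Pr i [set w | X 0%N w = i] = 1%E)
    (hirr : irreducible_mx (trans_mx Q))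
    (hfin : forall i j, mean_sojourn_to Q i j \is a fin_num)
    (pi : 'cV[R]_m)
    (hpi : pi^T *m trans_mx Q = pi^T)
    (hpi1 : pi^T *m ones = 1%:M)
    (lambda : R)
    (hlambda : lambda = (pi^T *m mean_sojourn Q) 0 0)
    (lambda_gt0 : 0 < lambda) :
  let P := trans_mx Q in
  let mu := mean_sojourn Q in
  let e := ones : 'cV[R]_m in
  let Pi := e *m pi^T in
  let k1 := kvec1 Pr X T pi in
  [/\ forall G : 'M[R]_m, g_inverse (1%:M - P) G ->
        k1 = map_mx EFin
          (G *m mu - \tr (G *m mu *m pi^T) *: e + lambda *: e
           - lambda *: (G *m e) + (lambda * \tr G) *: e),
      (1%:M - P + Pi \in unitmx) /\
      (let Z := invmx (1%:M - P + Pi) in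
        k1 = map_mx EFin
          (Z *m mu - \tr (Z *m mu *m pi^T) *: e + (lambda * \tr Z) *: e)),
      forall A : 'M[R]_m, group_inverse (1%:M - P) A ->
        k1 = map_mx EFin
          (A *m mu - \tr (A *m mu *m pi^T) *: e + lambda *: e
           + (lambda * \tr A) *: e)
    & forall u : 'cV[R]_m, (u^T *m e) 0 0 != 0 ->
        (1%:M - P + mu *m u^T \in unitmx) /\
        (let G := invmx (1%:M - P + mu *m u^T) in
          k1 = map_mx EFin
            (lambda *: ((1%:M - G + (\tr G)%:M) *m e)))].
Proof.
move=> P mu e Pi k1.
have P_ge0 i k : 0 <= P i k := trans_mx_ge0 (hMRP i) (hstart i) k.
have P_sum1 : P *m ones = ones.
  apply/colP => i; rewrite !mxE -[RHS](trans_mx_sum1 (hMRP i) (hstart i)).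
  by apply: eq_bigr => k _; rewrite [ones _ _]mxE mulr1.
have lambdaE : pi^T *m mu = lambda%:M by rewrite [LHS]mx11_scalar -hlambda.
have k1E : k1 = map_mx EFin (first_passage_mx P mu *m pi).
  apply/colP => i; rewrite !mxE -sumEFin; apply: eq_bigr => j _.
  rewrite muleC EFinM; congr (_ * _)%E.
  exact: (mean_first_passageE (hMRP i) (hstart i) j hfin P_ge0 P_sum1 hirr).
have k1G G : g_inverse (1%:M - P) G -> k1 = map_mx EFin
    (G *m mu - \tr (G *m mu *m pi^T) *: e + lambda *: e
     - lambda *: (G *m e) + (lambda * \tr G) *: e).
  move=> gG; rewrite k1E; congr map_mx.
  exact: (g_inverse_first_passage_mx P_ge0 P_sum1 hirr hpi hpi1 lambdaE).
split=> [//|||u ue].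
(* The case [a = ones], [b = pi], [s = t = 1]: then [Z e = e], so the terms [lambda e] and
   [lambda Z e] cancel. *)
- split.
    exact: (rank1_perturbation_unit P_ge0 P_sum1 hirr hpi hpi1 (oner_neq0 _)
      hpi1 (oner_neq0 _)).
  have [gZ Ze] := rank1_perturbation_g_inverse P_ge0 P_sum1 hirr hpi hpi1
    (oner_neq0 _) hpi1 (oner_neq0 _).
  by rewrite (k1G _ gZ) Ze invr1 scale1r addrK.
- move=> A [gA AgA comm]; rewrite (k1G _ gA).
  (* This follows from [A = A (I - P) A = A A (I - P)] and [(I - P) e = 0]. *)
  suff -> : A *m e = 0 by rewrite scaler0 subr0.
  have Ae : (1%:M - P) *m e = 0 by rewrite mulmxBl mul1mx P_sum1 subrr.
  by rewrite -AgA -(mulmxA A) comm -!mulmxA Ae !mulmx0.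
- have uE : u^T *m ones = ((u^T *m e) 0 0)%:M by rewrite -mx11_scalar.
  have l0 : lambda != 0 by rewrite gt_eqF.
  split.
    exact: (rank1_perturbation_unit P_ge0 P_sum1 hirr hpi lambdaE l0 uE ue).
  have [gG Gmu] :=
    rank1_perturbation_g_inverse P_ge0 P_sum1 hirr hpi lambdaE l0 uE ue.
  (* [G mu] is [(u^T e)^-1] times [e], and the trace of [G mu pi^T] is that same scalar, so the
     first two terms cancel. *)
  rewrite (k1G _ gG) Gmu; congr map_mx; set G := invmx _.
  rewrite -scalemxAl mxtraceZ mxtrace_mulC hpi1 mxtrace1 mulr1 subrr add0r.
  rewrite mulmxDl mulmxBl mul1mx mul_scalar_mx scalerDr scalerBr scalerA.
  by [].
Qed.
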